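(* Let $n\geq 5$ and let $Q_n$ be the $n$-dimensional hypercube. Then $$\rho'(Q_n)\leq \frac{\lceil \log_2 n\rceil+4}{2}\,\bigl(\lceil \log_2 n\rceil+1\bigr).$$
   Context: The hypercube $Q_n$ is the Cartesian product of $n$ copies of $K_2$. An edge coloring of a graph is distinguishing if no automorphism other than the identity preserves it. $D'(G)$ is the least number of colors in a distinguishing edge coloring of $G$. When $D'(G)=2$, the cost of edge-distinguishing $\rho'(G)$ is the minimum number of edges in the smaller color class over all distinguishing edge colorings of $G$ with two colors. *)

(* Defs.v *)
From HB Require Import structures.
From mathcomp Require Import all_boot all_order all_fingroup all_algebra.

Set Implicit Arguments.
Unset Strict Implicit.
Unset Printing Implicit Defensive.

Record sgraph := SGraph {
  svertex :> finType;
  sadj : rel svertex;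
  sadj_sym : symmetric sadj;
  sadj_irrefl : irreflexive sadj }.

Definition edges (G : sgraph) : {set {set G}} :=
  [set [set p.1; p.2] | p : G * G & sadj p.1 p.2].

Definition edge (G : sgraph) : finType := {e : {set G} | e \in edges G}.

Definition automorphism (G : sgraph) (f : {perm G}) : Prop :=
  forall x y : G, sadj (f x) (f y) = sadj x y.

Definition edge_coloring (G : sgraph) (k : nat) : Type := {ffun edge G -> 'I_k}.

(* An automorphism acts on edges by taking images; e' is the image of e. *)
Definition preserves_coloring (G : sgraph) (k : nat)
    (f : {perm G}) (c : edge_coloring G k) : Prop :=
  forall e e' : edge G, val e' = f @: val e -> c e' = c e.

Definition distinguishing (G : sgraph) (k : nat) (c : edge_coloring G k) : Prop :=
  forall f : {perm G}, automorphism f -> preserves_coloring f c -> f = 1%g.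

(* D'(G) = k.  This is a relation because D'(G) need not exist: in K_2, for
   instance, swapping the two vertices preserves every edge coloring. *)
Definition is_dist_index (G : sgraph) (k : nat) : Prop :=
  (exists c : edge_coloring G k, distinguishing c) /\
  (forall j : nat, (exists c : edge_coloring G j, distinguishing c) -> k <= j).

Definition smaller_class (G : sgraph) (c : edge_coloring G 2) : nat :=
  minn #|[set e | c e == ord0]| #|[set e | c e == ord_max]|.

(* rho'(G) = r.  This includes D'(G) = 2, without which rho'(G) is undefined. *)
Definition is_dist_cost (G : sgraph) (r : nat) : Prop :=
  [/\ is_dist_index G 2,
      exists2 c : edge_coloring G 2, distinguishing c & smaller_class c = r
    & forall c : edge_coloring G 2, distinguishing c -> r <= smaller_class c].

Section CartesianPower.
Variables (G : sgraph) (n : nat).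

Definition cart_adj : rel {ffun 'I_n -> G} := fun x y =>
  [exists i, sadj (x i) (y i) && [forall j, (j != i) ==> (x j == y j)]].

Lemma cart_adj_sym : symmetric cart_adj.
Proof.
move=> x y; apply: eq_existsb => i; rewrite sadj_sym; congr (_ && _).
by apply: eq_forallb => j; rewrite [x j == _]eq_sym.
Qed.

Lemma cart_adj_irrefl : irreflexive cart_adj.
Proof. by move=> x; apply/existsP => -[i]; rewrite sadj_irrefl. Qed.

Definition cart_power : sgraph := SGraph cart_adj_sym cart_adj_irrefl.
End CartesianPower.

Definition complete_adj (m : nat) : rel 'I_m := fun x y => x != y.

Lemma complete_adj_sym (m : nat) : symmetric (@complete_adj m).
Proof. by move=> x y; rewrite /complete_adj eq_sym. Qed.

Lemma complete_adj_irrefl (m : nat) : irreflexive (@complete_adj m).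
Proof. by move=> x; rewrite /complete_adj eqxx. Qed.

Definition complete_graph (m : nat) : sgraph :=
  SGraph (@complete_adj_sym m) (@complete_adj_irrefl m).

Definition hypercube (n : nat) : sgraph := cart_power (complete_graph 2) n.

(* Main.v *)
(** Put k = up_log 2 n and colour red the edges of k + 1 stars with 2, 3, ...,
    k + 2 edges, so that 2 + 3 + ... + (k + 2) = (k + 4)(k + 1) / 2 edges are red.
    If the centres are far enough apart for no two stars to meet, then the
    centres are recognised by their red degrees and every colour-preserving
    automorphism fixes them.  Automorphisms preserve the Hamming distance, so an
    automorphism fixing vertices whose coordinate vectors separate the n
    directions fixes everything.  As n <= 2^k, the zero vertex and k further
    vertices can separate the directions; the only difficulty is to keep the
    stars apart when n is small compared with k. *)

Require Import Defs.
From HB Require Import structures.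
From mathcomp Require Import all_boot all_order all_fingroup all_algebra.
From mathcomp Require Import zify lra.

Set Implicit Arguments.
Unset Strict Implicit.
Unset Printing Implicit Defensive.

Import Order.TTheory GRing.Theory Num.Theory.
Local Open Scope ring_scope.

(** * Hamming distance and automorphisms of the hypercube *)

Section Flips.
Local Open Scope nat_scope.
Variable n : nat.
Implicit Types (x y z v : {ffun 'I_n -> 'I_2}) (a b : 'I_n).

Definition diff x y : {set 'I_n} := [set i | x i != y i].

Definition flip x a : {ffun 'I_n -> 'I_2} :=
  [ffun j => if j == a then rev_ord (x j) else x j].

Lemma ord2_neq (s t : 'I_2) : (s != t) = (t == rev_ord s).
Proof. by case: s t => [[|[|?]] ?] [[|[|?]] ?]. Qed.

Lemma rev_ord2_neq (s : 'I_2) : s != rev_ord s.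
Proof. by rewrite ord2_neq. Qed.

Lemma diffC x y : diff x y = diff y x.
Proof. by apply/setP=> i; rewrite !inE eq_sym. Qed.

Lemma diff_eq0 x y : (diff x y == set0) = (x == y).
Proof.
apply/eqP/eqP => [d0|->]; last by apply/setP=> i; rewrite !inE eqxx.
by apply/ffunP=> i; move/setP/(_ i): d0; rewrite !inE => /negbFE/eqP.
Qed.

Lemma diffxx x : diff x x = set0.
Proof. by apply/eqP; rewrite diff_eq0. Qed.

Lemma diff_inj x : injective (diff x).
Proof.
move=> y z /setP d; apply/ffunP=> i; move: (d i); rewrite !inE.
by move: (x i) (y i) (z i) => [[|[|?]] ?] [[|[|?]] ?] [[|[|?]] ?] //= _; apply: val_inj.
Qed.

Lemma diff_subU x y z : diff x z \subset diff x y :|: diff y z.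
Proof.
by apply/subsetP=> i; rewrite !inE; case: (x i =P y i) => [->|].
Qed.

Lemma diff_flipr x a : diff x (flip x a) = [set a].
Proof.
apply/setP=> i; rewrite !inE ffunE.
by case: (i =P a) => _; rewrite ?rev_ord2_neq ?eqxx.
Qed.

Lemma diff_flip x y a : diff (flip x a) (flip y a) = diff x y.
Proof.
apply/setP=> i; rewrite !inE !ffunE.
by case: (i =P a) => // _; rewrite (inj_eq rev_ord_inj).
Qed.

Lemma flipK a : involutive (flip^~ a).
Proof.
move=> x; apply/ffunP=> i; rewrite !ffunE.
by case: (i =P a) => // _; rewrite rev_ordK.
Qed.

Lemma flip_inj x : injective (flip x).
Proof. by move=> a b e; apply: set1_inj; rewrite -!(diff_flipr x) e. Qed.

Lemma flip_neq x a : flip x a != x.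
Proof. by rewrite eq_sym -diff_eq0 diff_flipr -cards_eq0 cards1. Qed.

Lemma diff_set1 x y a : diff x y = [set a] -> y = flip x a.
Proof.
move=> d; apply/ffunP=> i; rewrite ffunE; move/setP/(_ i): d; rewrite !inE.
by case: (i =P a) => _; [rewrite ord2_neq => /eqP | move/negbFE/eqP].
Qed.

(** Turns membership in a difference set into a comparison of distances, which automorphisms
    respect. *)
Lemma flip_closer x v a :
  (#|diff (flip x a) v| < #|diff x v|) = (a \in diff x v).
Proof.
have rest : diff (flip x a) v :\ a = diff x v :\ a.
  apply/setP=> i; rewrite !inE ffunE.
  by case: (i =P a).
rewrite (cardsD1 a (diff (flip x a) v)) (cardsD1 a (diff x v)) rest ltn_add2r.
rewrite !inE ffunE eqxx.
by move: (x a) (v a) => [[|[|?]] ?] [[|[|?]] ?].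
Qed.

Lemma hypercube_adjP (x y : hypercube n) :
  reflect (exists a, y = flip x a) (sadj x y).
Proof.
apply: (iffP existsP) => [[a /andP[xya /forallP e]]|[a ->]]; exists a.
  apply: diff_set1; apply/setP=> i; rewrite !inE.
  case: (i =P a) => [->//|/eqP ia].
  by move/implyP: (e i) => /(_ ia) ->.
rewrite /= /complete_adj ffunE eqxx rev_ord2_neq /=.
by apply/forallP=> j; apply/implyP=> ja; rewrite ffunE (negbTE ja).
Qed.

Lemma hypercube_adjE (x y : hypercube n) : sadj x y = (#|diff x y| == 1).
Proof.
apply/hypercube_adjP/cards1P => -[a]; first by move=> ->; exists a; rewrite diff_flipr.
by move/diff_set1; exists a.
Qed.

Lemma automorphismV (G : sgraph) (f : {perm G}) :
  automorphism f -> automorphism (f^-1)%g.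
Proof. by move=> af x y; rewrite -af !permKV. Qed.

(** Induction on the distance: flipping a direction of [diff x y] moves [x] one step closer to [y],
    and the image of that step is again an edge, so the triangle inequality applies. *)
Lemma automorphism_diff_le (f : {perm hypercube n}) (x y : hypercube n) :
  automorphism f -> #|diff (f x) (f y)| <= #|diff x y|.
Proof.
move=> af; have [m] := ubnP #|diff x y|; elim: m x => // m IH x lem.
have [d0|[a ad]] := set_0Vmem (diff x y).
  by move/eqP: (d0); rewrite diff_eq0 => /eqP ->; rewrite diffxx cards0.
have closer : #|diff (flip x a) y| < #|diff x y| by rewrite flip_closer.
have le_zy := IH (flip x a) (leq_trans closer lem).
have : sadj (f x) (f (flip x a)) by rewrite af; apply/hypercube_adjP; exists a.
rewrite hypercube_adjE => /eqP xz1.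
apply: leq_trans (subset_leq_card (diff_subU (f x) (f (flip x a)) (f y))) _.
apply: leq_trans (leq_card_setU _ _) _.
by rewrite xz1 add1n; apply: leq_ltn_trans closer.
Qed.

Lemma automorphism_diff (f : {perm hypercube n}) (x y : hypercube n) :
  automorphism f -> #|diff (f x) (f y)| = #|diff x y|.
Proof.
move=> af; apply/eqP; rewrite eqn_leq automorphism_diff_le //=.
have := automorphism_diff_le (f x) (f y) (automorphismV af).
by rewrite !permK.
Qed.

Lemma automorphism_flip (f : {perm hypercube n}) (x v : hypercube n) a b :
  automorphism f -> f (flip x a) = flip (f x) b ->
  (b \in diff (f x) (f v)) = (a \in diff x v).
Proof.
by move=> af e; rewrite -!flip_closer -e !automorphism_diff.
Qed.

(** [f] permutes the neighbours of [x], hence the directions. A direction and its image lie in the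
    same sets [diff x w], so they are equal; then [diff x (f v) = diff x v] for every [v]. *)
Lemma fix_resolving (f : {perm hypercube n}) (x : hypercube n)
    (W : {set hypercube n}) :
  automorphism f -> f x = x -> {in W, forall w, f w = w} ->
  (forall a b, {in W, forall w, (a \in diff x w) = (b \in diff x w)} -> a = b) ->
  f = 1%g.
Proof.
move=> af fx fW sepW.
have f1 a : f (flip x a) = flip (f x) a.
  have : sadj (f x) (f (flip x a)) by rewrite af; apply/hypercube_adjP; exists a.
  case/hypercube_adjP=> b e; rewrite e; congr flip; apply: sepW => w wW.
  by rewrite -(automorphism_flip w af e) fx fW.
apply/permP=> v; rewrite perm1.
have: diff x (f v) = diff x v.
  by apply/setP=> a; rewrite -{1}fx (automorphism_flip v af (f1 a)).
exact: diff_inj.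
Qed.

(** With at most one colour, flipping one coordinate is a nontrivial automorphism that preserves the
    colouring. *)
Lemma hypercube_dist_index_ge2 (j : nat) (c : edge_coloring (hypercube n) j) :
  0 < n -> distinguishing c -> 2 <= j.
Proof.
move=> n0 dc; rewrite ltnNge; apply/negP=> j1.
pose a := Ordinal n0; pose f := perm (inv_inj (flipK a)) : {perm hypercube n}.
have eq_ord (s t : 'I_j) : s = t.
  by apply: val_inj; move: (ltn_ord s) (ltn_ord t) => /=; lia.
have f1 : f = 1%g.
  apply: dc => [x y|e e' _]; last exact: eq_ord.
  by rewrite !hypercube_adjE !permE diff_flip.
have := flip_neq [ffun=> ord0] a; rewrite -[flip _ a](permE (inv_inj (flipK a))).
by rewrite -/f f1 perm1 eqxx.
Qed.
End Flips.

(** * Existence of the cost *)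

Section Cost.
Local Open Scope nat_scope.
Variables (G : sgraph).

(** A boolean form, so that a minimum over the finitely many colourings can be taken. *)
Definition distinguishingb k (c : edge_coloring G k) :=
  [forall f : {perm G},
     [forall x, forall y, sadj (f x) (f y) == sadj x y] ==>
     [forall e : edge G, forall e' : edge G,
        (val e' == f @: val e) ==> (c e' == c e)] ==> (f == 1%g)].

Lemma distinguishingP k (c : edge_coloring G k) :
  reflect (distinguishing c) (distinguishingb c).
Proof.
apply: (iffP forallP) => [h f af pf|h f].
  move/implyP: (h f) => /(_ _)/implyP h'; apply/eqP; apply: h'.
    by apply/forallP=> x; apply/forallP=> y; rewrite af.
  apply/forallP=> e; apply/forallP=> e'; apply/implyP=> /eqP ee'.
  by rewrite (pf e e').
apply/implyP=> /forallP af; apply/implyP=> /forallP pf; apply/eqP.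
apply: h => [x y|e e' ee']; first by move/forallP: (af x) => /(_ y)/eqP.
by move/forallP: (pf e) => /(_ e')/implyP; rewrite ee' eqxx => /(_ isT)/eqP.
Qed.

Lemma dist_cost_exists (c : edge_coloring G 2) :
  (forall j (c' : edge_coloring G j), distinguishing c' -> 2 <= j) ->
  distinguishing c -> exists2 r, is_dist_cost G r & r <= smaller_class c.
Proof.
move=> ge2 dc; have /distinguishingP bc := dc.
case: (@arg_minnP _ c (@distinguishingb 2) (@smaller_class G) bc) => c0 /distinguishingP dc0 cmin.
exists (smaller_class c0); last exact: cmin.
split=> [|  |c' /distinguishingP/cmin//]; last by exists c0.
by split=> [|j [c']]; [exists c | exact: ge2].
Qed.
End Cost.

(** * Coloured stars and the recognition of their centres *)

Lemma set2_eq (T : finType) (x y z t : T) :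
  [set x; y] = [set z; t] -> (x = z /\ y = t) \/ (x = t /\ y = z).
Proof.
move=> e; have: x \in [set z; t] by rewrite -e set21.
have yzt: y \in [set z; t] by rewrite -e set22.
have zxy: z \in [set x; y] by rewrite e set21.
have txy: t \in [set x; y] by rewrite e set22.
move: yzt zxy txy; rewrite !inE => /pred2P yzt /pred2P zxy /pred2P txy /pred2P.
by case=> ?; subst x; [left | right]; split=> //; case: yzt zxy txy => ? [] ? [] ?; subst.
Qed.

Section Stars.
Local Open Scope nat_scope.
Variables (n k : nat) (cen : 'I_k -> hypercube n) (D : 'I_k -> {set 'I_n}).

Definition star_edges : {set {set hypercube n}} :=
  [set [set cen p.1; flip (cen p.1) p.2 : hypercube n]
     | p : 'I_k * 'I_n & p.2 \in D p.1].

Definition star_coloring : edge_coloring (hypercube n) 2 :=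
  [ffun e => if val e \in star_edges then ord0 else ord_max].

Definition star_nbrs (x : hypercube n) : {set hypercube n} :=
  [set y | [set x; y] \in star_edges].

Lemma star_edgesP (x y : hypercube n) :
  reflect (exists i a, a \in D i /\
             ((x = cen i /\ y = flip (cen i) a) \/
              (x = flip (cen i) a /\ y = cen i)))
          ([set x; y] \in star_edges).
Proof.
apply: (iffP imsetP) => [[[i a]]|[i [a [aD h]]]].
  by rewrite inE /= => aD /set2_eq h; exists i, a.
exists (i, a); rewrite ?inE //=.
by case: h => -[-> ->] //; rewrite setUC.
Qed.

Lemma star_edges_adj (x y : hypercube n) :
  [set x; y] \in star_edges -> sadj x y.
Proof.
case/star_edgesP=> i [a [_ [[-> ->]|[-> ->]]]]; last rewrite sadj_sym.
all: by apply/hypercube_adjP; exists a.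
Qed.

Lemma smaller_class_star : smaller_class star_coloring <= \sum_i #|D i|.
Proof.
have cardP : #|[set p : 'I_k * 'I_n | p.2 \in D p.1]| = \sum_i #|D i|.
  rewrite -sum1_card (eq_bigr (fun i => \sum_(a in D i) 1)); last first.
    by move=> i _; rewrite sum1_card.
  by rewrite pair_big_dep /=; apply: eq_bigl => p; rewrite inE.
rewrite -cardP; apply: leq_trans (leq_imset_card _ _ : #|star_edges| <= _).
apply: leq_trans (geq_minl _ _) _; rewrite -(card_imset _ val_inj).
apply: subset_leq_card; apply/subsetP=> _ /imsetP[e + ->].
by rewrite inE ffunE; case: ifP.
Qed.

Lemma star_edges_auto (f : {perm hypercube n}) (x y : hypercube n) :
  automorphism f -> preserves_coloring f star_coloring ->
  ([set f x; f y] \in star_edges) = ([set x; y] \in star_edges).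
Proof.
move=> af pf; have [xy|nxy] := boolP (sadj x y); last first.
  by apply/idP/idP=> /star_edges_adj; rewrite ?af (negbTE nxy).
have edgeI (u v : hypercube n) : sadj u v -> [set u; v] \in edges (hypercube n).
  by move=> uv; apply/imsetP; exists (u, v); rewrite ?inE.
have fxy : sadj (f x) (f y) by rewrite af.
pose mk u v uv : edge (hypercube n) :=
  exist (fun e => e \in edges (hypercube n)) _ (edgeI u v uv).
have := pf (mk _ _ xy) (mk _ _ fxy).
rewrite !ffunE /= imsetU1 imset_set1 => /(_ erefl).
by case: ifP; case: ifP.
Qed.

Lemma star_nbrs_auto (f : {perm hypercube n}) (x : hypercube n) :
  automorphism f -> preserves_coloring f star_coloring ->
  star_nbrs (f x) = f @: star_nbrs x.
Proof.
move=> af pf; apply/setP=> y; rewrite inE -{1}(permKV f y) star_edges_auto //.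
by rewrite -{2}(permKV f y) (mem_imset _ _ perm_inj) inE.
Qed.

Hypothesis D_neq0 : forall i, D i != set0.
Hypothesis cen_sep : forall i j a b, i != j -> a \in D i -> b \in D j ->
  ~~ (diff (cen i) (cen j) \subset [set a; b]).

Lemma star_nbrs_cen i : star_nbrs (cen i) = flip (cen i) @: D i :> {set hypercube n}.
Proof.
apply/setP=> y; rewrite inE; apply/star_edgesP/imsetP => [[j [b [bD h]]]|[a aD ->]].
  have [ij|ij] := eqVneq i j.
    subst j; exists b => //; case: h => -[] // /esym/eqP.
    by rewrite (negbTE (flip_neq _ _)).
  have /set0Pn[a aD] := D_neq0 i.
  move: (cen_sep ij aD bD); case: h => -[-> _]; first by rewrite diffxx sub0set.
  by rewrite diffC diff_flipr subsetUr.
by exists i, a; split; [|left].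
Qed.

Lemma card_star_nbrs_cen i : #|star_nbrs (cen i)| = #|D i|.
Proof. by rewrite star_nbrs_cen card_imset //; apply: flip_inj. Qed.

(** Two such neighbours would be centres of two stars sharing the leaf [x], so the centres would
    differ at most in the two leaf directions, against [cen_sep]. *)
Lemma card_star_nbrs_le1 x : (forall i, x != cen i) -> #|star_nbrs x| <= 1.
Proof.
move=> xc; apply/card_le1_eqP=> y z; rewrite !inE.
move=> /star_edgesP[i [a [aD [[/eqP]|[xi ->]]]]]; first by rewrite (negbTE (xc i)).
move=> /star_edgesP[j [b [bD [[/eqP]|[xj ->]]]]]; first by rewrite (negbTE (xc j)).
have [->//|ij] := eqVneq i j; case/negP: (cen_sep ij aD bD).
apply: subset_trans (diff_subU _ x _) _.
by rewrite {1}xi xj diff_flipr diffC diff_flipr.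
Qed.

(** The image of a centre keeps its red degree. Being at least 2, this degree forces a centre; the
    degrees of the centres being distinct, it is the same centre. *)
Lemma star_cen_fixed (f : {perm hypercube n}) i :
  (forall j, 1 < #|D j|) -> injective (fun j => #|D j|) ->
  automorphism f -> preserves_coloring f star_coloring -> f (cen i) = cen i.
Proof.
move=> D2 Dinj af pf.
have cardf : #|star_nbrs (f (cen i))| = #|D i|.
  by rewrite star_nbrs_auto // card_imset ?card_star_nbrs_cen //; apply: perm_inj.
have [/existsP[j /eqP fj]|/existsPn nc] := boolP [exists j, f (cen i) == cen j].
  by move: cardf; rewrite fj card_star_nbrs_cen => /Dinj ->.
by have := D2 i; rewrite -cardf ltnNge card_star_nbrs_le1.
Qed.
End Stars.

(** * Coordinates of the centres *)

Section Centres.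
Local Open Scope nat_scope.

(* The coordinate vectors of the first m + 3 directions: with t the last unit
   vector of F_2^(m+1), they are 0, t, e_0 + t, ..., e_(m-1) + t and, in position
   m + 2, the sum e_0 + ... + e_(m-1). *)
Definition column_bit (m p j : nat) : bool :=
  if p == m.+2 then j != m else (0 < p) && ((j == m) || (j.+2 == p)).

Lemma column_bit_inj (m p q : nat) : 1 < m -> p < m.+3 -> q < m.+3 ->
  (forall j, j < m.+1 -> column_bit m p j = column_bit m q j) -> p = q.
Proof.
move=> m1; wlog pq : p q / p < q.
  move=> wl pm qm e; have [lt|lt|//] := ltngtP p q; first exact: wl.
  by apply/esym; apply: wl => // j jm; rewrite e.
move=> _ qm e; have pm : (p == m.+2) = false by lia.
(* If [q] is the last column, row [m] forces [p = 0] and row 0 then differs. Otherwise row [m] gives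
   [0 < p], and row [q - 2] is 1 in column [q] only. *)
move: (e m (ltnSn m)) (e 0 isT) (e q.-2); rewrite /column_bit pm !eqxx /=.
by case: (q =P m.+2) => [_|qm2]; lia.
Qed.

(** The prescribed vectors are distinct; listing the remaining vectors after them gives [2 ^ m.+1]
    distinct columns, enough for [n] directions. *)
Lemma columns_exist (m n : nat) : 1 < m -> m.+3 <= n <= 2 ^ m.+1 ->
  exists2 col : nat -> {ffun 'I_m.+1 -> bool},
    forall p j, p < m.+3 -> col p j = column_bit m p j
    & forall p q, p < n -> q < n -> col p = col q -> p = q.
Proof.
move=> m1 /andP[mn nm].
pose s := mkseq (fun p => [ffun j : 'I_m.+1 => column_bit m p j]) m.+3.
pose r := [seq x <- enum {ffun 'I_m.+1 -> bool} | x \notin s].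
have us : uniq s.
  rewrite map_inj_in_uniq ?iota_uniq // => p q; rewrite !mem_iota /= => pm qm.
  move/ffunP=> e; apply: (@column_bit_inj m) => // j jm.
  by have := e (Ordinal jm); rewrite !ffunE.
have ut : uniq (s ++ r).
  rewrite cat_uniq us filter_uniq ?enum_uniq // andbT.
  by apply/hasPn=> x; rewrite mem_filter => /andP[].
have st : n <= size (s ++ r).
  apply: leq_trans nm _.
  have -> : 2 ^ m.+1 = #|{ffun 'I_m.+1 -> bool}| by rewrite card_ffun card_bool card_ord.
  rewrite cardE; apply: uniq_leq_size (enum_uniq _) _ => x _.
  by rewrite mem_cat mem_filter mem_enum andbT orbN.
exists (nth [ffun=> false] (s ++ r)) => [p j pm|p q pn qn /eqP].
  by rewrite nth_cat size_mkseq pm nth_mkseq // ffunE.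
by rewrite nth_uniq ?(leq_trans _ st) // => /eqP.
Qed.

(* Coordinate p of the i-th centre, for i <= m + 1.  The centre m is the zero
   vertex, which shifts the row number of the last centre to m.  The i-th star
   leaves its centre in the directions 0, ..., i + 1. *)
Definition centre_bit (col : nat -> nat -> bool) (m i p : nat) : bool :=
  (i != m) && col p (minn i m).

(* Two leaves a and b of distinct stars coincide, or a leaf is a centre, only if
   the two centres agree outside {a, b}. *)
Lemma centre_bit_sep (m i j a b : nat) :
  1 < m -> i < j -> j < m.+2 -> a < i.+2 -> b < j.+2 ->
  exists s, [/\ s < m.+3, s != a, s != b &
    centre_bit (column_bit m) m i s != centre_bit (column_bit m) m j s].
Proof.
move=> m1 ij jm ai bj; rewrite /centre_bit /column_bit.
have [jm1|jm1|jm1] := ltngtP j m.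
(* The column [e_j + t] is 1 in row [j], 0 in row [i], and its position exceeds both leaf
   directions. *)
- exists j.+2; rewrite (minn_idPl (ltnW (ltn_trans ij jm1))).
  have -> : (j.+2 == m.+2) = false by lia.
  by split; lia.
- have [im|im] := ltnP i m.
    (* The direction [e_l' + t], with l' in {0, 1} other than i. *)
    pose l := if i == 0 then 3 else 2.
    have [l2 lm li] : [/\ 1 < l, l < m.+2 & i.+2 != l].
      by rewrite /l; case: eqP => ?; split; lia.
    (* The centres differ at three distinct coordinates, and [a], [b] exclude at most two. *)
    have : (1 != a) && (1 != b) || ((m.+2 != a) && (m.+2 != b)) || ((l != a) && (l != b)).
      by lia.
    case/orP => [/orP[]|] /andP[sa sb]; [exists 1|exists m.+2|exists l].
    + by rewrite (_ : (1 == m.+2) = false); last lia; split; lia.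
    + by rewrite !eqxx; split; lia.
    + by rewrite (_ : (l == m.+2) = false); last lia; split; lia.
  (* Here [i = m] is the zero centre, while row [m] is 1 in the columns [t], [e_0 + t],
     [e_1 + t]. *)
  have : (1 != a) && (1 != b) || ((2 != a) && (2 != b)) || ((3 != a) && (3 != b)) by lia.
  case/orP => [/orP[]|] /andP[sa sb]; [exists 1|exists 2|exists 3].
  + by rewrite (_ : (1 == m.+2) = false); last lia; split; lia.
  + by rewrite (_ : (2 == m.+2) = false); last lia; split; lia.
  + by rewrite (_ : (3 == m.+2) = false); last lia; split; lia.
- subst j; exists m.+2; rewrite !eqxx (minn_idPl (ltnW ij)).
  by split; lia.
Qed.
End Centres.

(** * The distinguishing colouring *)

Section Construction.
Local Open Scope nat_scope.
Variables (m n : nat).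
Hypotheses (m1 : 1 < m) (mn : m.+3 <= n <= 2 ^ m.+1).

Lemma hypercube_distinguishing_coloring :
  exists2 c : edge_coloring (hypercube n) 2,
    distinguishing c & smaller_class c <= \sum_(i < m.+2) i.+2.
Proof.
have [col colE col_inj] := columns_exist m1 mn.
pose bit i p := centre_bit (fun p j => col p (inord j)) m i p.
have bitE i p : p < m.+3 -> bit i p = centre_bit (column_bit m) m i p.
  by move=> pm; rewrite /bit /centre_bit colE // inordK // ltnS geq_minr.
pose cen (i : 'I_m.+2) : hypercube n :=
  [ffun p : 'I_n => if bit i p then ord_max else ord0].
pose D (i : 'I_m.+2) := [set p : 'I_n | p < i.+2].
have in_diff i j p : (p \in diff (cen i) (cen j)) = (bit i p != bit j p).
  by rewrite inE !ffunE; case: (bit i p); case: (bit j p).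
have [m3n _] := andP mn.
have cardD i : #|D i| = i.+2.
  have im : i.+2 <= n by apply: leq_trans m3n; rewrite ltnS.
  have -> : D i = widen_ord im @: [set: 'I_i.+2].
    apply/setP=> p; rewrite inE; apply/idP/imsetP => [pi|[q _ ->]]; last exact: (ltn_ord q).
    by exists (Ordinal pi) => //; apply: val_inj.
  by rewrite card_imset ?cardsT ?card_ord // => x y /(congr1 val) /= /val_inj.
have D2 i : 1 < #|D i| by rewrite cardD.
have D0 i : D i != set0 by rewrite -card_gt0 cardD.
have sep i j a b : i != j -> a \in D i -> b \in D j ->
    ~~ (diff (cen i) (cen j) \subset [set a; b]).
  wlog ij : i j a b / i < j.
    move=> wl ij aD bD; have [lt|lt|/val_inj e] := ltngtP i j; first exact: wl.
      by rewrite diffC setUC; apply: wl => //; rewrite eq_sym.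
    by rewrite e eqxx in ij.
  move=> _; rewrite !inE => ai bj.
  have [s [sm sa sb e]] := centre_bit_sep m1 ij (ltn_ord j) ai bj.
  have sn : s < n := leq_trans sm m3n.
  apply/subsetPn; exists (Ordinal sn).
    by rewrite in_diff !bitE.
  by rewrite !inE -!(inj_eq val_inj) /= negb_or sa.
exists (star_coloring cen D); last first.
  by apply: leq_trans (smaller_class_star _ _) _; rewrite (eq_bigr _ (fun i _ => cardD i)).
move=> f af pf.
have fcen i : f (cen i) = cen i.
  apply: (star_cen_fixed D0 sep _ D2 _ af pf) => j j'.
  by rewrite !cardD => -[] /val_inj.
have mm : m < m.+2 by [].
apply: (@fix_resolving _ f (cen (Ordinal mm)) (cen @: setT)) => //.
  by move=> _ /imsetP[i _ ->].
move=> a b e; apply: val_inj; apply: col_inj => //=; apply/ffunP=> j.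
(* Differences from the zero centre read off rows: row [j] from centre [j], but row [m] from centre
   [m + 1]. *)
have jm : (if j == m :> nat then m.+1 else j) < m.+2.
  by case: ifP => // _; apply: ltnW; rewrite ltnS.
have := e _ (imset_f cen (in_setT (Ordinal jm))); rewrite !in_diff /bit /centre_bit /= eqxx.
have -> : minn (if j == m :> nat then m.+1 else j) m = j.
  by case: (nat_of_ord j =P m) (ltn_ord j) => [->|]; lia.
have -> : (if j == m :> nat then m.+1 else j) != m.
  by case: (nat_of_ord j =P m) => ?; lia.
by rewrite inord_val /=; do 2!case: (col _ _).
Qed.
End Construction.

(** * The numerical bound, with [up_log 2 n = m + 1] *)

Lemma sum_star_sizes (m : nat) : (2 * \sum_(i < m.+2) i.+2 = (m + 5) * (m + 2))%N.
Proof.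
elim: m => [|m IH]; first by rewrite !big_ord_recr big_ord0.
by rewrite big_ord_recr /= (mulnDr 2) IH; lia.
Qed.

Theorem theorem5p9 (n : nat) (hn : (5 <= n)%N) :
  exists r : nat, is_dist_cost (hypercube n) r /\
    (r%:R : rat) <= ((up_log 2 n)%:R + 4) / 2 * ((up_log 2 n)%:R + 1).
Proof.
have n1 : (1 < n)%N by apply: leq_trans hn.
have /andP[] := up_log_bounds (isT : 1 < 2)%N n1.
case: (up_log 2 n) => [|m] /= lo up; first by lia.
have m1 : (1 < m)%N by case: m {lo} up => [|[|//]]; lia.
(* Room for the prescribed columns: [m + 2 <= 2 ^ m < n] once [m] is at least 2. *)
have m3n : (m.+3 <= n)%N.
  suff : (m.+2 <= 2 ^ m)%N by lia.
  by elim: m m1 {lo up} => // -[|[|m]] IH // _; rewrite expnS; have := IH isT; lia.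
have mn : (m.+3 <= n <= 2 ^ m.+1)%N by rewrite m3n.
have [c dc le_c] := hypercube_distinguishing_coloring m1 mn.
have ge2 j (c' : edge_coloring (hypercube n) j) : distinguishing c' -> (2 <= j)%N.
  by apply: hypercube_dist_index_ge2; apply: ltnW.
have [r costr le_r] := dist_cost_exists ge2 dc.
exists r; split=> //.
have : (2 * r <= (m + 5) * (m + 2))%N.
  by rewrite -sum_star_sizes leq_mul2l (leq_trans le_r).
by rewrite -(ler_nat rat) !natrM !natrD -[m.+1%:R]natr1; lra.
Qed.
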